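(* Let $t>1$ be fixed. The online $t$-net-cost algorithm (without recourse) is $O(\log\Delta)$-competitive for online minimum cost matching on the line on alternating instances, where $$\Delta=\max_{r,r'\in R,\; s,s'\in S}\frac{c(r,s)}{c(r',s')}.$$ That is, on every alternating instance with request set $R$ and server set $S$, the online matching $M'$ it produces satisfies $c(M')\le O(\log\Delta)\cdot\mathrm{OPT}$.
   Context: Online minimum cost matching on the line: a finite set $S\subset\mathbb{R}$ of servers is known in advance. Requests $r_1,\dots,r_n\in\mathbb{R}$, with $n\le|S|$, arrive one by one and each must be matched on arrival, immediately and irrevocably, to a previously unmatched server. The cost of an edge between request $r$ and server $s$ is $c(r,s)=|r-s|$, assumed positive. The cost $c(M)$ of a set of edges $M$ is the sum of its edge costs. $\mathrm{OPT}$ is the minimum cost of a matching that matches all requests. $R=\{r_1,\dots,r_n\}$. An instance is alternating if between any two requests on the line there is at least one server. For $t>1$, a matching $M$ and an alternating path $P$ with respect to $M$, the $t$-net-cost of $P$ is $\phi_t^{M}(P)=t\cdot c(P\setminus M)-c(P\cap M)$. The offline $t$-net-cost algorithm maintains a matching $M^*$, starting with $M^*_0=\emptyset$. On arrival of $r_i$ it chooses an alternating path $P_i$ with respect to $M^*_{i-1}$ from $r_i$ to some server $s_i$ that is free (unmatched in $M^*_{i-1}$), of minimum $t$-net-cost $\phi_t^{M^*_{i-1}}(P_i)$ among all such paths, and sets $M^*_i=M^*_{i-1}\oplus P_i$ (symmetric difference). The online $t$-net-cost algorithm runs this as an auxiliary procedure and builds its output by directly connecting the endpoints of $P_i$: $M'_0=\emptyset$,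 $M'_i=M'_{i-1}\cup\{(r_i,s_i)\}$, $M'=M'_n$. The constant hidden in the $O$-notation may depend on $t$ but not on the instance; $O(\log\Delta)$ is understood as at most a constant times $1+\log\Delta$ (which matters only when $\Delta$ is close to $1$). *)

(* Defs.v *)
From HB Require Import structures.
From mathcomp Require Import all_boot all_order all_algebra finmap.
From mathcomp Require Import reals exp.

Set Implicit Arguments.
Unset Strict Implicit.
Unset Printing Implicit Defensive.

Import Order.TTheory GRing.Theory Num.Theory.
Local Open Scope ring_scope.

(* Requests are identified with their arrival indices 0, ..., n - 1, the
   request i being located at r i; servers are the elements of the finite set
   S of reals. *)
Definition edge (R : realType) (n : nat) (S : {fset R}) : finType :=
  ('I_n * S)%type.

Definition vertex (R : realType) (n : nat) (S : {fset R}) : finType :=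
  ('I_n + S)%type.

Definition ecost (R : realType) (n : nat) (S : {fset R}) (r : 'I_n -> R)
    (e : edge n S) : R :=
  `|r e.1 - val e.2|.

Definition cost (R : realType) (n : nat) (S : {fset R}) (r : 'I_n -> R)
    (M : {set edge n S}) : R :=
  \sum_(e in M) ecost r e.

(* Two requests are two distinct indices, so that in an alternating instance
   the requests have pairwise distinct locations. *)
Definition alternating_instance (R : realType) (n : nat) (S : {fset R})
    (r : 'I_n -> R) : Prop :=
  forall i j : 'I_n, i != j -> r i <= r j ->
    exists s : S, r i < val s < r j.

Definition is_matching (R : realType) (n : nat) (S : {fset R})
    (M : {set edge n S}) : bool :=
  [forall e in M, forall f in M,
    ((e.1 == f.1) || (e.2 == f.2)) ==> (e == f)].

Definition matches_all_requests (R : realType) (n : nat) (S : {fset R})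
    (M : {set edge n S}) : bool :=
  [forall i : 'I_n, exists s : S, (i, s) \in M].

(* The default value, the cost of all edges together, is at least the cost of
   any matching; hence this is the minimum as soon as n <= #|` S|. *)
Definition OPT (R : realType) (n : nat) (S : {fset R}) (r : 'I_n -> R) : R :=
  \big[Num.min/cost r [set: edge n S]]_(M : {set edge n S} |
     is_matching M && matches_all_requests M) cost r M.

(* The pair of edges e = (r, s) and f = (r', s') encodes the quadruple
   r, r', s, s'; the default value 0 only matters when there is no edge. *)
Definition Delta (R : realType) (n : nat) (S : {fset R}) (r : 'I_n -> R) : R :=
  \big[Num.max/0]_(e : edge n S) \big[Num.max/0]_(f : edge n S)
     (ecost r e / ecost r f).

Definition edge_between (R : realType) (n : nat) (S : {fset R})
    (x y : vertex n S) : option (edge n S) :=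
  match x, y with
  | inl i, inr s | inr s, inl i => Some (i, s)
  | _, _ => None
  end.

(* As in the path library, a path is given by its first vertex x and the
   sequence p of the vertices following x. *)
Definition path_edges (R : realType) (n : nat) (S : {fset R})
    (x : vertex n S) (p : seq (vertex n S)) : seq (edge n S) :=
  pmap id (pairmap (@edge_between R n S) x p).

Definition alternating_path (R : realType) (n : nat) (S : {fset R})
    (M : {set edge n S}) (x : vertex n S) (p : seq (vertex n S)) : bool :=
  [&& uniq (x :: p),
      path (fun y z => edge_between y z) x p
    & sorted (fun e f => (e \in M) != (f \in M)) (path_edges x p)].

Definition free_server (R : realType) (n : nat) (S : {fset R})
    (M : {set edge n S}) (s : S) : bool :=
  [forall i : 'I_n, (i, s) \notin M].

Definition candidate_path (R : realType) (n : nat) (S : {fset R})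
    (M : {set edge n S}) (i : 'I_n) (p : seq (vertex n S)) (s : S) : bool :=
  [&& alternating_path M (inl i) p, last (inl i) p == inr s
    & free_server M s].

Definition net_cost (R : realType) (n : nat) (S : {fset R}) (r : 'I_n -> R)
    (t : R) (M P : {set edge n S}) : R :=
  t * cost r (P :\: M) - cost r (P :&: M).

Definition symdiff (T : finType) (A B : {set T}) : {set T} :=
  (A :\: B) :|: (B :\: A).

Definition edge_set (R : realType) (n : nat) (S : {fset R})
    (x : vertex n S) (p : seq (vertex n S)) : {set edge n S} :=
  [set e in path_edges x p].

(* M k is the offline matching after k arrivals; request i, which is the
   (i + 1)-st to arrive, is processed with the path P i, which ends in the
   server s i. Ties may be broken arbitrarily. *)
Definition offline_run (R : realType) (n : nat) (S : {fset R})
    (r : 'I_n -> R) (t : R) (M : nat -> {set edge n S})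
    (P : 'I_n -> seq (vertex n S)) (s : 'I_n -> S) : Prop :=
  M 0%N = set0 /\
  forall i : 'I_n,
    [/\ candidate_path (M i) i (P i) (s i),
        forall (p : seq (vertex n S)) (s' : S), candidate_path (M i) i p s' ->
          net_cost r t (M i) (edge_set (inl i) (P i))
            <= net_cost r t (M i) (edge_set (inl i) p)
      & M i.+1 = symdiff (M i) (edge_set (inl i) (P i))].

Definition online_matching (R : realType) (n : nat) (S : {fset R})
    (s : 'I_n -> S) : {set edge n S} :=
  [set ((i, s i) : edge n S) | i in 'I_n].

Definition online_output (R : realType) (n : nat) (S : {fset R})
    (r : 'I_n -> R) (t : R) (M' : {set edge n S}) : Prop :=
  exists (M : nat -> {set edge n S}) (P : 'I_n -> seq (vertex n S))
         (s : 'I_n -> S),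
    offline_run r t M P s /\ M' = online_matching s.

(* Main.v *)
Require Import Defs.
From HB Require Import structures.
From mathcomp Require Import all_boot all_order all_algebra finmap.
From mathcomp Require Import reals exp.
From mathcomp Require Import ring lra zify.

Set Implicit Arguments.
Unset Strict Implicit.
Unset Printing Implicit Defensive.

Import Order.TTheory GRing.Theory Num.Theory.
Local Open Scope ring_scope.

(* Let phi_i be the t-net-cost of P_i.  Telescoping c(M*_i) - c(M*_(i-1)) gives
   (t - 1) c(M') <= 2 (phi_1 + ... + phi_n), so it suffices to show that at most
   2 t (t + 1) OPT / a of the phi_i are at least a, for every a > 0: then the
   k-th largest phi_i is at most 2 t (t + 1) OPT / k, the sum is harmonic, and
   n <= 1 + Delta because the requests are separated by servers.

   Each M*_i admits a dual solution, and by complementary slackness and t > 1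
   it uses only edges with no server strictly inside.  Hence on arrival of r_i
   there is a free server between r_i and any later request r_j, so
   phi_i <= t |r_i - r_j|, and requests with phi_i >= a are pairwise a / t
   apart.  Moreover, a fixed optimal matching sends a surplus of requests past
   r_i either rightwards or leftwards; following the alternating chain in
   that direction up to a free server f, the matching pays on [r_i, f] at least
   (|r_i - f| + phi_i) / (t + 1).  Greedily picking disjoint such intervals
   bounds the number of requests with phi_i >= a. *)

(** * Potentials on the residual graph and the primal-dual step *)

Section Duality.
Variables (R : realFieldType) (Q V : finType) (c : Q -> V -> R) (t : R).
Implicit Types (M : {set Q * V}) (y : Q + V -> R).

Definition matching M : Prop :=
  (forall q s s', (q, s) \in M -> (q, s') \in M -> s = s') /\
  (forall q q' s, (q, s) \in M -> (q', s) \in M -> q = q').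

Definition unmatched M (q : Q) : bool := [forall s, (q, s) \notin M].

Definition unused M (s : V) : bool := [forall q, (q, s) \notin M].

(* [y] is a potential on the residual graph: an edge outside of the matching
   is traversed from request to server at cost [t * c q s], a matching edge
   from server to request at cost [- c q s]. *)
Record feasible M y : Prop := Feasible {
  feasible_le : forall q s, y (inl q) <= t * c q s + y (inr s);
  feasible_matched : forall q s, (q, s) \in M ->
    y (inl q) = c q s + y (inr s);
  feasible_ge0 : forall s, 0 <= y (inr s);
  feasible_unused : forall s, unused M s -> y (inr s) = 0 }.

Definition residual M : rel (Q + V) := fun x z =>
  match x, z with
  | inl q, inr s => (q, s) \notin M
  | inr s, inl q => (q, s) \in M
  | _, _ => false
  end.

(** Only edges outside of [M] need an equation: [feasible] already forces equality on the edges of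
    [M]. *)
Definition tight M y : rel (Q + V) := fun x z =>
  match x, z with
  | inl q, inr s => ((q, s) \notin M) && (y (inl q) == t * c q s + y (inr s))
  | inr s, inl q => (q, s) \in M
  | _, _ => false
  end.

Lemma connect_last (T : finType) (e : rel T) x z :
  connect e x z -> z = x \/ exists2 w, connect e x w & e w z.
Proof.
case/connectP=> p; case: (lastP p) => [|{}p w] /=; first by left.
rewrite rcons_path last_rcons => /andP[xp pw] ->; right.
by exists (last x p) => //; apply/connectP; exists p.
Qed.

(** The dual update of the Hungarian method: raise [y] on the whole reachable set by the least slack
    of an edge leaving it. Tight steps inside the set survive, and the minimising edge becomes tight
    and leads to a new vertex. *)
Lemma feasible_raise M y i f : matching M -> unmatched M i -> unused M f ->
  feasible M y ->
  (forall s, connect (tight M y) (inl i) (inr s) -> ~~ unused M s) ->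
  exists2 y', feasible M y' &
    [set x | connect (tight M y) (inl i) x] \proper
    [set x | connect (tight M y') (inl i) x].
Proof.
move=> [M1 M2] iM fM [yle yM y0 yf] noZ.
pose Z := [set x | connect (tight M y) (inl i) x].
pose slack (e : Q * V) := t * c e.1 e.2 + y (inr e.2) - y (inl e.1).
pose A (e : Q * V) := (inl e.1 \in Z) && (inr e.2 \notin Z).
(* No matching edge crosses the boundary of [Z]: [i] is unmatched, and any other request is reached
   only through its own partner. *)
have ZM q s : (q, s) \in M -> (inl q \in Z) = (inr s \in Z).
  move=> qs; apply/idP/idP; rewrite !inE; last first.
    by move=> /connect_trans; apply; apply: connect1.
  case/connect_last => [[qi]|[[q'|s'] //= cs' s'q]].
    by move/forallP: iM => /(_ s); rewrite -qi qs.
  by rewrite (M1 _ _ _ qs s'q).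
have A0 : A (i, f).
  rewrite /A /= inE connect0 /= inE; apply/negP => /noZ; by rewrite fM.
case: (arg_minP slack A0) => -[q s] /= /andP[/= qZ sZ] smin.
pose eps := slack (q, s).
have eps0 : 0 < eps.
  have := yle q s; rewrite /eps /slack /= => h.
  rewrite subr_gt0 lt_neqAle h andbT; apply/eqP => E.
  move/negP: sZ; apply; case: (boolP ((q, s) \in M)) => [/ZM <-//|qsM].
  move: qZ; rewrite !inE => /connect_trans; apply; apply: connect1.
  by rewrite /= qsM E eqxx.
pose y' x := if x \in Z then y x + eps else y x.
have y'M q' s' : (q', s') \in M -> y' (inl q') - y' (inr s') =
   y (inl q') - y (inr s').
  by move=> e; rewrite /y' (ZM _ _ e); case: ifP => _; ring.
exists y'.
  split.
  - move=> q' s'; have := yle q' s'; rewrite /y'.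
    case: (boolP (inl q' \in Z)) => qZ'; case: (boolP (inr s' \in Z)) => sZ'.
    + lra.
    + have := smin (q', s'); rewrite /A qZ' sZ' => /(_ isT).
      rewrite -/eps /slack /=; lra.
    + lra.
    + by [].
  - move=> q' s' e; have := y'M _ _ e; rewrite (yM _ _ e); lra.
  - move=> s'; rewrite /y'; have := y0 s'; case: ifP => _; lra.
  - move=> s' fs; rewrite /y' (yf _ fs); case: ifP => // /[!inE] /noZ.
    by rewrite fs.
have sub : Z \subset [set x | connect (tight M y') (inl i) x].
  apply/subsetP => x; rewrite !inE => /connectP[p].
  elim/last_ind: p x => [x _ ->|p x IH x'] /=; first exact: connect0.
  rewrite rcons_path last_rcons => /andP[ip px] ->.
  apply: connect_trans (IH _ ip erefl) _; apply: connect1.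
  have lZ : last (inl i) p \in Z by rewrite inE; apply/connectP; exists p.
  have xZ : x \in Z.
    rewrite inE; apply: connect_trans (connect1 px).
    by move: lZ; rewrite inE.
  case: (last (inl i) p) x px lZ xZ => [q'|s'] [q''|s''] //=.
  case/andP=> -> /= /eqP E lZ xZ; rewrite /y' lZ xZ E; apply/eqP; ring.
apply/properP; split=> //; exists (inr s) => //.
rewrite inE; have: inl q \in Z by [].
move/(subsetP sub); rewrite inE => /connect_trans; apply; apply: connect1.
rewrite /= /y' qZ (negbTE sZ); apply/andP; split.
  by apply/negP => /ZM; rewrite qZ (negbTE sZ).
by rewrite /eps /slack /=; apply/eqP; ring.
Qed.

Lemma feasible_augmentable M y i f : matching M -> unmatched M i ->
  unused M f -> feasible M y ->
  exists y' f', [/\ feasible M y', unused M f' &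
    connect (tight M y') (inl i) (inr f')].
Proof.
move=> MM iM fM; pose Z y := [set x | connect (tight M y) (inl i) x].
have [k] := ubnP (#|[set: Q + V]| - #|Z y|)%N; elim: k => // k IH in y *.
move=> le_k yM.
case: (pickP (fun s => connect (tight M y) (inl i) (inr s) && unused M s)).
  by move=> s /andP[cs fs]; exists y, s.
move=> noZ; have [s /= cs|y' y'M prop] := feasible_raise MM iM fM yM.
  by have:= noZ s; rewrite cs /= => /negbT.
apply: (IH y') => //; have := proper_card prop; rewrite -!/(Z _).
have : (#|Z y'| <= #|[set: Q + V]|)%N by apply/subset_leq_card/subsetT.
lia.
Qed.

(** Server potentials are kept, and each request is repriced at its partner in [M'], or at 0 if it
    has none. On a newly used tight edge this lowers [t * c q s + y (inr s)] to [c q s + y (inr s)],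
    which cannot violate an upper bound. *)
Lemma feasible_rematch M M' y : 1 <= t -> (forall q s, 0 <= c q s) ->
  matching M' ->
  (forall q s, (q, s) \in M' -> y (inl q) <> c q s + y (inr s) ->
     y (inl q) = t * c q s + y (inr s)) ->
  (forall s, unused M' s -> unused M s) ->
  feasible M y -> exists y', feasible M' y'.
Proof.
move=> t1 c0 [M1 M2] tM' uM' fy.
exists (fun x => match x with
  | inr s => y (inr s)
  | inl q => if [pick s | (q, s) \in M'] is Some s then c q s + y (inr s) else 0
  end); split=> [q s|q s qs|s|s /uM'].
- case: pickP => [s' qs'|_]; last first.
    by rewrite addr_ge0 ?mulr_ge0 ?(feasible_ge0 fy) // (le_trans ler01).
  apply: le_trans (feasible_le fy q s).
  have [->|/eqP ne] := eqVneq (y (inl q)) (c q s' + y (inr s')); first by [].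
  by rewrite (tM' _ _ qs' ne) lerD2r ler_peMl.
- by case: pickP => [s' /M1 /(_ qs) ->|/(_ s)]; rewrite ?qs.
- exact: feasible_ge0 fy s.
- by move=> us; exact: (feasible_unused fy us).
Qed.
End Duality.

(** * Geometry of matchings on the line, and chains of adjacent edges *)

Definition between (R : realDomainType) (a b x : R) : bool :=
  (a < x < b) || (b < x < a).

Lemma betweenN (R : realDomainType) (a b x : R) :
  between (- a) (- b) (- x) = between a b x.
Proof. by rewrite /between !ltrN2 orbC andbC [X in _ || X]andbC. Qed.

Section Line.
Variables (R : realFieldType) (Q V : finType).
Implicit Types (u : Q -> R) (v : V -> R) (M : {set Q * V}) (y : Q + V -> R).

Definition dist u v q s : R := `|u q - v s|.

Definition alternates u v : Prop :=
  forall i j, i != j -> u i <= u j -> exists s, u i < v s < u j.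

Definition adjacent u v M : Prop :=
  forall q s w, (q, s) \in M -> ~~ between (u q) (v s) (v w).

Lemma distN u v q s : dist (\- u) (\- v) q s = dist u v q s.
Proof. by rewrite /dist /= -opprD normrN. Qed.

Lemma alternatesN u v : injective u -> alternates u v -> alternates (\- u) (\- v).
Proof.
move=> iu a i j ij /=; rewrite lerN2 => ji.
have [|s /andP[h1 h2]] := a j i _ ji; first by rewrite eq_sym.
by exists s; rewrite /= !ltrN2 h1 h2.
Qed.

Lemma alternates_inj u v : alternates u v -> injective u.
Proof.
move=> a i j e; apply/eqP; case: eqVneq => // ij.
have [|s] := a i j ij; first by rewrite e.
by rewrite e => /andP[/lt_trans h /h]; rewrite ltxx.
Qed.

Lemma adjacentN u v M : adjacent u v M -> adjacent (\- u) (\- v) M.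
Proof. by move=> a q s w e; rewrite betweenN; apply: a. Qed.

Lemma feasibleN u v t M y :
  feasible (dist u v) t M y -> feasible (dist (\- u) (\- v)) t M y.
Proof. by case=> *; split=> // *; rewrite distN; auto. Qed.

Lemma nearest_right v (x : R) (s : V) : x < v s ->
  exists2 w, x < v w & (v w <= v s) && [forall z, ~~ (x < v z < v w)].
Proof.
move=> xs; case: (@arg_minP _ _ _ s (fun w => x < v w) v xs) => w xw wm.
exists w => //; rewrite wm //=; apply/forallP => z; apply/negP => /andP[xz].
by rewrite ltNge wm.
Qed.

(* A detour through a server inside a tight edge would be strictly cheaper,
   because [t > 1].  The last hypothesis covers the case where that server is
   the partner of [q] itself: then [q0] could go to [s] directly. *)
Lemma adjacent_tight u v t M y q s w : 1 < t ->
  (forall q s, u q != v s) -> alternates u v -> adjacent u v M ->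
  feasible (dist u v) t M y ->
  y (inl q) = t * dist u v q s + y (inr s) ->
  (forall s', (q, s') \in M ->
     exists q0, y (inl q0) = t * dist u v q0 s' + y (inr s')) ->
  ~~ between (u q) (v s) (v w).
Proof.
suff right u' v' : 1 < t -> (forall q s, u' q != v' s) -> alternates u' v' ->
    adjacent u' v' M -> feasible (dist u' v') t M y ->
    y (inl q) = t * dist u' v' q s + y (inr s) ->
    (forall s', (q, s') \in M ->
       exists q0, y (inl q0) = t * dist u' v' q0 s' + y (inr s')) ->
    ~~ (u' q < v' w < v' s).
  move=> t1 ne a ad fe e1 e2; rewrite negb_or right //=.
  rewrite andbC -[v s < _]ltrN2 -[v w < _]ltrN2; apply: (right (\- u) (\- v)).
  - by [].
  - by move=> *; rewrite eqr_opp.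
  - exact: (alternatesN (alternates_inj a) a).
  - exact: adjacentN.
  - exact: feasibleN.
  - by rewrite distN.
  - by move=> s' /e2[q0 e]; exists q0; rewrite distN.
move: u' v' => {}u {}v t1 ne a ad fe e1 e2; apply/negP => /andP[qw ws].
have [s' qs' /andP[s'w /forallP near]] := nearest_right qw.
have s's : v s' < v s by exact: le_lt_trans ws.
have ys := feasible_ge0 fe s; have yqs' := feasible_le fe q s'.
have dqs : dist u v q s = v s - u q.
  by rewrite /dist distrC gtr0_norm // subr_gt0 (lt_trans qs').
have dqs' : dist u v q s' = v s' - u q.
  by rewrite /dist distrC gtr0_norm // subr_gt0.
have prod : 0 < (t - 1) * (v s' - u q) by rewrite mulr_gt0 // subr_gt0.
have prod2 : 0 < (t - 1) * (v s - v s') by rewrite mulr_gt0 // subr_gt0.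
case: (boolP (unused M s')) => [f0|].
  rewrite (feasible_unused fe f0) in yqs'.
  rewrite e1 dqs dqs' in yqs'; lra.
case/forallPn => q' /negPn q's'.
have yq' := feasible_matched fe q's'.
have [qq'|qq'] := eqVneq q q'.
  have [|q0 e0] := e2 s'; first by rewrite qq'.
  have h := feasible_le fe q0 s; move: yq'; rewrite -qq' e1 dqs dqs' => yq'.
  have tri : dist u v q0 s <= dist u v q0 s' + (v s - v s').
    rewrite -(@gtr0_norm _ (v s - v s')) ?subr_gt0 // (distrC (v s)).
    exact: ler_distD.
  have : t * dist u v q0 s <= t * (dist u v q0 s' + (v s - v s')).
    by rewrite ler_wpM2l //; lra.
  lra.
(* The partner [q'] of [s'] is confined to the gap between [s'] and [s]: further left, alternation
   puts a server inside its edge or before [s']; further right, [s] lies inside its edge. Rerouting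
   [q] to [s'] and [q'] to [s] then saves [(t + 1) * (u q' - v s')]. *)
have q'_gt : v s' < u q'.
  rewrite lt_neqAle eq_sym ne /= leNgt; apply/negP => q's.
  have [q'q|qq''] := leP (u q') (u q).
    have [|z /andP[z1 z2]] := a q' q _ q'q; first by rewrite eq_sym.
    have := ad _ _ z q's'; rewrite /between z1 (lt_trans z2) //.
  have [z /andP[z1 z2]] := a q q' qq' (ltW qq'').
  by have := near z; rewrite z1 (lt_trans z2).
have q'_lt : u q' < v s.
  rewrite lt_neqAle ne /=; rewrite leNgt; apply/negP => sq'.
  by have := ad _ _ s q's'; rewrite /between s's sq' orbT.
have h := feasible_le fe q' s.
have d1 : dist u v q' s' = u q' - v s' by rewrite /dist gtr0_norm ?subr_gt0.
have d2 : dist u v q' s = v s - u q'.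
  by rewrite /dist distrC gtr0_norm ?subr_gt0.
move: h yqs'; rewrite yq' e1 d1 d2 dqs dqs' => h yqs'.
have prod3 : 0 < (t + 1) * (u q' - v s') by rewrite mulr_gt0 ?subr_gt0 //; lra.
lra.
Qed.

(** One link of the rightward chain. If the nearest server [s] had its partner on the left, a server
    separating that partner from [q] would lie inside the matching edge or between [q] and [s]. *)
Lemma next_right u v M q z : (forall q s, u q != v s) -> alternates u v ->
  adjacent u v M -> (forall s, (q, s) \in M -> v s < u q) -> u q < v z ->
  exists s, [/\ u q < v s, v s <= v z, forall w, ~~ (u q < v w < v s) &
    unused M s \/ exists q', [/\ (q', s) \in M, v s < u q' &
                                forall w, ~~ (v s < v w < u q')]].
Proof.
move=> ne a ad ql qz; have [s qs /andP[sz /forallP near]] := nearest_right qz.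
exists s; split=> //; case: (boolP (unused M s)); [by left|move=> us; right].
case/forallPn: us => q' /negPn q's; exists q'.
have q'_gt : v s < u q'.
  have [e|qq'] := eqVneq q q'.
    by rewrite -e; apply: ql; rewrite e.
  rewrite lt_neqAle eq_sym ne /= leNgt; apply/negP => q's_lt.
  have [q'q|qq''] := leP (u q') (u q).
    have [|x /andP[z1 z2]] := a q' q _ q'q; first by rewrite eq_sym.
    have := ad _ _ x q's; rewrite /between z1 (lt_trans z2) //.
  have [x /andP[z1 z2]] := a q q' qq' (ltW qq'').
  by have := near x; rewrite z1 (lt_trans z2).
split=> // w; have := ad _ _ w q's; rewrite /between negb_or.
by case/andP.
Qed.

Lemma unused_between_right u v M q z : (forall q s, u q != v s) ->
  alternates u v -> matching M -> adjacent u v M ->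
  (forall s, (q, s) \in M -> v s < u q) -> unmatched M z -> u q < u z ->
  exists2 s, unused M s & u q < v s < u z.
Proof.
move=> ne a [M1 M2] ad; have [k] := ubnP #|[set s | u q < v s]|.
elim: k => // k IH in q * => le_k ql zM qz.
have [|w /andP[qw wz]] := a q z _ (ltW qz).
  by apply: contraTneq qz => ->; rewrite ltxx.
have [s [qs sw near [fs|[q' [q's sq' near']]]]] := next_right ne a ad ql qw.
  by exists s; rewrite // qs (le_lt_trans sw).
(* The chain cannot jump over [z]: alternation would put a server between [z] and [q'], hence inside
   the edge [(q', s)]. *)
have q'z : u q' < u z.
  rewrite ltNge; apply/negP => zq'.
  have [|x /andP[zx xq']] := a z q' _ zq'.
    by apply: contraTneq q's => <-; move/forallP: zM => /(_ s).
  by have := near' x; rewrite xq' (le_lt_trans sw) // (lt_trans wz).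
have [||x fx /andP[q'x xz]] := IH q' _ _ zM q'z.
- rewrite -ltnS; apply: leq_trans le_k; rewrite ltnS; apply: proper_card.
  apply/properP; split; last first.
    by exists s; rewrite !inE // -leNgt ltW.
  apply/subsetP => x; rewrite !inE; apply: lt_trans; exact: lt_trans sq'.
- by move=> s' /M1 => /(_ s q's) ->.
- by exists x => //; rewrite xz (lt_trans _ q'x) // (lt_trans qs).
Qed.

Lemma unused_between u v M q z : (forall q s, u q != v s) ->
  alternates u v -> matching M -> adjacent u v M ->
  unmatched M q -> unmatched M z -> q != z ->
  exists2 s, unused M s & between (u q) (u z) (v s).
Proof.
move=> ne a m ad qM zM qz; have iu := alternates_inj a.
have noq s : (q, s) \in M -> False.
  by move=> h; move/forallP: qM => /(_ s); rewrite h.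
have [lt|lt|e] := ltgtP (u q) (u z).
- have [s fs h] := unused_between_right ne a m ad
    (fun s h => False_ind _ (noq s h)) zM lt.
  by exists s; rewrite // /between h.
- have [] := @unused_between_right (\- u) (\- v) M q z.
  + by move=> *; rewrite eqr_opp.
  + exact: alternatesN.
  + by [].
  + exact: adjacentN.
  + by move=> s /noq.
  + by [].
  + by rewrite ltrN2.
  + by move=> s fs; rewrite !ltrN2 andbC => h; exists s; rewrite // /between h orbT.
- by move/eqP: qz; case; apply: iu.
Qed.

(* [o] stands for an arbitrary offline matching; clamping at [x] keeps the
   part of its edges to the right of [x]. *)
Definition cost_right u v (o : Q -> V) (x : R) : R :=
  \sum_i `|Num.max (u i) x - Num.max (v (o i)) x|.

Definition excess u v (o : Q -> V) (x : R) : bool :=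
  (#|[set i | (v (o i) <= x)%R]| < #|[set i | (u i <= x)%R]|)%N.

Lemma max_dist_mono (a b x z : R) : x <= z ->
  `|Num.max a z - Num.max b z| <= `|Num.max a x - Num.max b x|.
Proof.
move=> xz; case: (leP a z); case: (leP b z); case: (leP a x); case: (leP b x);
  move=> *; rewrite ?subrr ?normr0 //; do ?case: ger0P => *; lra.
Qed.

Lemma cost_right_mono u v o x z : x <= z ->
  cost_right u v o z <= cost_right u v o x.
Proof. by move=> xz; apply: ler_sum => i _; apply: max_dist_mono. Qed.

Lemma cost_right_ge0 u v o x : 0 <= cost_right u v o x.
Proof. exact: sumr_ge0. Qed.

Lemma cost_right_le u v o x :
  cost_right u v o x <= \sum_i dist u v i (o i).
Proof.
apply: ler_sum => i _; rewrite /dist; case: (leP (u i) x);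
 case: (leP (v (o i)) x) => *; rewrite ?subrr ?normr0 //;
 do ?case: ger0P => *; lra.
Qed.

Lemma excess_crossing u v o x : excess u v o x ->
  exists i, u i <= x < v (o i).
Proof.
move=> ex; have : ~~ ([set i | u i <= x] \subset [set i | v (o i) <= x]).
  by apply/negP => /subset_leq_card; rewrite leqNgt -/(excess u v o x) ex.
by case/subsetPn => i; rewrite !inE -ltNge => h1 h2; exists i; rewrite h1.
Qed.

(** The surplus of requests forces an edge of [o] across [u q]. With no server before [s], that edge
    covers the whole gap, and clamping at [v s] instead of [u q] removes the gap from its cost. *)
Lemma excess_right u v o q s : excess u v o (u q) -> u q < v s ->
  (forall w, ~~ (u q < v w < v s)) ->
  v s - u q <= cost_right u v o (u q) - cost_right u v o (v s).
Proof.
move=> /excess_crossing[i /andP[iq qi]] qs near.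
have si : v s <= v (o i) by rewrite leNgt; move: (near (o i)); rewrite qi.
rewrite /cost_right (bigD1 i) //= [X in _ <= _ - X](bigD1 i) //=.
have : \sum_(j | j != i) `|Num.max (u j) (v s) - Num.max (v (o j)) (v s)| <=
       \sum_(j | j != i) `|Num.max (u j) (u q) - Num.max (v (o j)) (u q)|.
  by apply: ler_sum => j _; apply/max_dist_mono/ltW.
have : `|Num.max (u i) (u q) - Num.max (v (o i)) (u q)| -
       `|Num.max (u i) (v s) - Num.max (v (o i)) (v s)| = v s - u q.
  rewrite (max_idPr iq) (max_idPl (ltW qi)).
  rewrite (max_idPr (le_trans iq (ltW qs))) (max_idPl si).
  rewrite distrC gtr0_norm ?subr_gt0 // distrC ger0_norm ?subr_ge0 //; ring.
lra.
Qed.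

(** Between [u q] and [u q'] the only server is [s], used by [o] at most once, while the request
    [q'] itself is gained; so the strict surplus persists. *)
Lemma excess_next u v o q s q' : injective o -> injective v ->
  u q < v s -> v s < u q' ->
  (forall w, ~~ (u q < v w < v s)) -> (forall w, ~~ (v s < v w < u q')) ->
  (forall q s, u q != v s) -> excess u v o (u q) -> excess u v o (u q').
Proof.
move=> io iv qs sq' near near' ne; rewrite /excess => ex.
have qq' := lt_trans qs sq'.
apply: (@leq_ltn_trans (#|[set i | (v (o i) <= u q)%R]| + 1)%N).
  apply: (@leq_trans #|[set i | v (o i) <= u q] :|: [set i | o i == s]|).
    apply/subset_leq_card/subsetP => i; rewrite !inE => iq'.
    case: leP => //= qi; apply/eqP/iv.
    have := near (o i); rewrite qi /= -leNgt => h.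
    have := near' (o i); rewrite [X in _ && X]lt_neqAle iq' eq_sym ne !andbT.
    by rewrite -leNgt => h'; apply/eqP; rewrite eq_le h h'.
  apply: (leq_trans (leq_card_setU _ _)); rewrite leq_add2l.
  apply/card_le1_eqP => i j; rewrite !inE => /eqP <- /eqP /io; auto.
apply: (@leq_trans #|q' |: [set i | (u i <= u q)%R]|).
  by rewrite cardsU1 inE -ltNge qq' addnC ltn_add2l.
apply/subset_leq_card/subsetP => i; rewrite !inE => /predU1P[->|] //.
by move=> /le_trans; apply; apply: ltW.
Qed.

(* Induction along the chain: the step from [q] through its server [s] to the
   next request [q'] adds at most [(t + 1) * (v s - u q)] to the left-hand side,
   as the contributions of the matching edge [(q', s)] to [f - u q] and to
   [y (inl q)] cancel, and at least as much to the right-hand side. *)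
Lemma excess_charge u v o t M y q : 0 <= t -> (forall q s, u q != v s) ->
  alternates u v -> injective v -> injective o ->
  matching M -> adjacent u v M -> feasible (dist u v) t M y ->
  (forall s, (q, s) \in M -> v s < u q) -> excess u v o (u q) ->
  exists f, u q < f /\ f - u q + y (inl q) <=
    (t + 1) * (cost_right u v o (u q) - cost_right u v o f).
Proof.
move=> t0 ne a iv io [M1 M2] ad fe; have [k] := ubnP #|[set s | u q < v s]|.
elim: k => // k IH in q * => le_k ql ex.
have [i /andP[iq qw]] := excess_crossing ex.
have [s [qs sw near nx]] := next_right ne a ad ql qw.
have e1 := excess_right ex qs near.
have := feasible_le fe q s.
have -> : dist u v q s = v s - u q.
  by rewrite /dist distrC gtr0_norm // subr_gt0.
move=> yq.
have e1' : (t + 1) * (v s - u q) <= (t + 1) *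
   (cost_right u v o (u q) - cost_right u v o (v s)).
  by rewrite ler_wpM2l // addr_ge0.
case: nx => [fs|[q' [q's sq' near']]].
  by exists (v s); split=> //; rewrite (feasible_unused fe fs) in yq; lra.
have [|||f [q'f hf]] := IH q'.
- rewrite -ltnS; apply: leq_trans le_k; rewrite ltnS; apply: proper_card.
  apply/properP; split; last first.
    by exists s; rewrite !inE // -leNgt ltW.
  apply/subsetP => x; rewrite !inE; apply: lt_trans; exact: lt_trans sq'.
- by move=> s' /M1 => /(_ s q's) ->.
- exact: (excess_next io iv qs sq' near near' ne ex).
exists f; split; first exact: lt_trans qs (lt_trans sq' q'f).
have := feasible_matched fe q's.
have -> : dist u v q' s = u q' - v s.
  by rewrite /dist gtr0_norm // subr_gt0.
have := cost_right_mono u v o (ltW sq') => h.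
have h' : 0 <= (t + 1) * (cost_right u v o (v s) - cost_right u v o (u q')).
  by rewrite mulr_ge0 ?subr_ge0 ?addr_ge0.
lra.
Qed.

(** The request [q] is counted on both sides of its own location but no server is, so a missing
    surplus on one side becomes a strict surplus after reflection. *)
Lemma excessN u v o q : (forall q s, u q != v s) -> injective u ->
  ~~ excess u v o (u q) -> excess (\- u) (\- v) o (- u q).
Proof.
rewrite /excess -leqNgt /= => ne iu le1.
have -> : [set i | - u i <= - u q] = q |: ~: [set i | u i <= u q].
  by apply/setP => i; rewrite !inE lerN2 le_eqVlt -ltNge eq_sym (inj_eq iu).
have -> : [set i | - v (o i) <= - u q] = ~: [set i | v (o i) <= u q].
  by apply/setP => i; rewrite !inE lerN2 le_eqVlt -ltNge (negbTE (ne _ _)).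
rewrite cardsU1 !inE lexx /= add1n ltnS.
have := cardsC [set i | u i <= u q]; have := cardsC [set i | v (o i) <= u q].
by lia.
Qed.
End Line.

(** * Counting separated points and summing a weak-type bound *)

Section Counting.
Variables (R : realFieldType) (Q : finType).
Implicit Types (u phi : Q -> R) (H : {set Q}).

(** Remove the leftmost point [i]; the others start at [u i + a / t] or later, so each removal uses
    up a length [a / t]. *)
Lemma separated_card u H (a t b c : R) : 0 < t -> 0 <= a -> b <= c ->
  (forall i, i \in H -> b <= u i <= c) ->
  {in H &, forall i j, i != j -> a <= t * `|u i - u j|} ->
  a * #|H|%:R <= t * (c - b) + a.
Proof.
move=> t0 a0; have [k] := ubnP #|H|; elim: k => // k IH in H b * => le_k bc.
move=> uH sep; have tcb : 0 <= t * (c - b) by rewrite mulr_ge0 ?subr_ge0 // ltW.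
have [->|[i0 i0H]] := set_0Vmem H; first by rewrite cards0 mulr0 addr_ge0.
case: (arg_minP u i0H) => i iH imin; have {}iH : i \in H := iH.
  rewrite (cardsD1 i) iH natrD mulrDr mulr1.
have far j : j \in H :\ i -> a / t <= u j - u i.
  rewrite !inE => /andP[ji jH]; rewrite ler_pdivrMr // mulrC.
  by have := sep j i jH iH ji; rewrite ger0_norm // subr_ge0 imin.
have /andP[bi ic] := uH i iH.
have [->|[j jH]] := set_0Vmem (H :\ i); first by rewrite cards0 mulr0; lra.
have : a * #|H :\ i|%:R <= t * (c - (u i + a / t)) + a.
  apply: IH.
  - by move: le_k; rewrite (cardsD1 i) iH.
  - have := far j jH; have := uH j; rewrite (subsetP (subsetDl _ _) _ jH).
    move=> /(_ isT); lra.
  - move=> l lH; have := far l lH; have := uH l.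
    by rewrite (subsetP (subsetDl _ _) _ lH) => /(_ isT); lra.
  - by move=> l m /setD1P[_ lH] /setD1P[_ mH]; apply: sep.
have -> : t * (c - (u i + a / t)) = t * (c - u i) - a by field; rewrite gt_eqF.
have : t * b <= t * u i by rewrite ler_wpM2l // ltW.
lra.
Qed.

(* Greedily choose disjoint intervals [[u i, f i]]; every point of [H] lies in
   one of them. *)
Lemma charged_card u H (T : R -> R) (a t K z : R) : 1 <= t -> 0 <= a ->
  0 <= K -> (forall x, 0 <= T x) -> {homo T : x y /~ x <= y} ->
  (forall i, i \in H -> exists f, u i < f /\
     f - u i + a <= K * (T (u i) - T f)) ->
  {in H &, forall i j, i != j -> a <= t * `|u i - u j|} ->
  (forall i, i \in H -> z <= u i) ->
  a * #|H|%:R <= t * K * T z.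
Proof.
move=> t1 a0 K0 T0 Tm; have t0 : 0 < t by exact: lt_le_trans t1.
 have [k] := ubnP #|H|; elim: k => // k IH in H z *.
move=> le_k cH sep zH.
have [->|[i0 i0H]] := set_0Vmem H.
  by rewrite cards0 mulr0 !mulr_ge0 // ltW.
case: (arg_minP u i0H) => i iH imin; have {}iH : i \in H := iH.
  have [f [uf hf]] := cH i iH.
pose H1 := [set j in H | u j < f]; pose H2 := [set j in H | f <= u j].
have cardH : #|H|%:R = #|H1|%:R + #|H2|%:R :> R.
  rewrite -natrD; congr _%:R.
  rewrite -(cardsID [set j | u j < f] H); congr (_ + _)%N; apply: eq_card => j.
    by rewrite !inE.
  by rewrite !inE -leNgt andbC.
have h2 : a * #|H2|%:R <= t * K * T f.
  apply: IH.
  - rewrite -ltnS; apply: leq_trans le_k; rewrite ltnS; apply: proper_card.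
    apply/properP; split; first by apply/subsetP => j /[!inE] /andP[].
    by exists i; rewrite // !inE iH /= -ltNge.
  - by move=> j /[!inE] /andP[jH _]; apply: cH.
  - by move=> j l /[!inE] /andP[jH _] /andP[lH _]; apply: sep.
  - by move=> j /[!inE] /andP[].
have h1 : a * #|H1|%:R <= t * (f - u i) + a.
  apply: (separated_card (u := u)) => //; first exact: ltW.
    move=> j /[!inE] /andP[jH /ltW uj]; by rewrite uj imin.
  by move=> j l /[!inE] /andP[jH _] /andP[lH _]; apply: sep.
(* The points below [f] are paid for by the drop of [T] up to [f], those beyond by [T f]; the extra
   [a] from [h1] is covered because [a <= t * a]. *)
have h3 : t * (f - u i + a) <= t * (K * (T (u i) - T f)).
  by rewrite ler_wpM2l // ltW.
have h4 : t * K * T (u i) <= t * K * T z.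
  by rewrite ler_wpM2l ?mulr_ge0 ?Tm ?zH // ltW.
have : a <= t * a by rewrite ler_peMl.
rewrite cardH; lra.
Qed.

(** All members of [H] are at least its smallest value, so that value is at most [B / #|H|];
    removing it and repeating yields the harmonic sum. *)
Lemma sum_weak_type phi H (B : R) : 0 <= B ->
  (forall a, 0 < a -> a * #|[set i | a <= phi i]|%:R <= B) ->
  \sum_(i in H) phi i <= B * \sum_(k < #|H|) k.+1%:R^-1.
Proof.
move=> B0 wk; have [k] := ubnP #|H|; elim: k => // k IH in H * => le_k.
have [->|[i0 i0H]] := set_0Vmem H.
  by rewrite big_set0 cards0 big_ord0 mulr0.
case: (arg_minP phi i0H) => i iH imin; have {}iH : i \in H := iH.
rewrite (big_setD1 i iH) /= (cardsD1 i H) iH add1n big_ord_recr /= mulrDr addrC.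
apply: lerD; first by apply: IH; move: le_k; rewrite (cardsD1 i H) iH.
rewrite ler_pdivlMr ?ltr0n //.
have [ge0|lt0] := leP (phi i) 0.
  by apply: le_trans B0; rewrite mulr_le0_ge0.
apply: le_trans (wk _ lt0); rewrite ler_wpM2l ?ler_nat //; first exact: ltW.
have -> : #|H :\ i|.+1 = #|H| by rewrite (cardsD1 i H) iH.
by apply/subset_leq_card/subsetP => j jH; rewrite inE imin.
Qed.
End Counting.

(** The induction step is [ln (1 - 1 / x) <= - 1 / x] at [x = n + 2]. *)
Lemma sum_inv_le_ln (R : realType) (n : nat) :
  \sum_(k < n.+1) (k.+1%:R : R)^-1 <= 1 + ln n.+1%:R.
Proof.
elim: n => [|n IH]; first by rewrite big_ord_recr big_ord0 /= add0r invr1 ln1 addr0.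
rewrite big_ord_recr /=; apply: le_trans (lerD IH (lexx _)) _.
rewrite -addrA lerD2l.
set x : R := n.+2%:R; have x0 : 0 < x by rewrite ltr0n.
have n0 : 0 < n.+1%:R :> R by rewrite ltr0n.
have -> : n.+1%:R = x * (1 + - x^-1).
  by rewrite mulrDr mulr1 mulrN divff ?gt_eqF // /x -[n.+2%:R]natr1 addrK.
have y0 : 0 < 1 - x^-1 by rewrite subr_gt0 invf_lt1 // ltr1n.
rewrite lnM ?posrE //; have : ln (1 + - x^-1) <= - x^-1 by apply: le_ln1Dx; rewrite ltrN2 invf_lt1 // ltr1n.
by move=> h; rewrite -addrA gerDl -lerBrDr sub0r.
Qed.

(** * Bounding the number of requests of large net-cost *)

Section Weight.
Variables (R : realFieldType) (Q V : finType) (u : Q -> R) (v : V -> R).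

(** Split [H] by the direction of the surplus under [o]. Each half is charged to the cost of [o],
    the second after reflection, whence the factor 2. *)
Lemma heavy_card (o : Q -> V) (H : {set Q}) (t a : R) : 1 < t -> 0 < a ->
  (forall q s, u q != v s) -> alternates u v -> injective v -> injective o ->
  (forall i, i \in H -> exists (M : {set Q * V}) (y : Q + V -> R),
    [/\ matching M, adjacent u v M, feasible (dist u v) t M y,
        unmatched M i & a <= y (inl i)]) ->
  {in H &, forall i j, i != j -> a <= t * `|u i - u j|} ->
  a * #|H|%:R <= 2 * t * (t + 1) * \sum_i dist u v i (o i).
Proof.
move=> t1 a0 ne alt iv io hH sep; have iu := alternates_inj alt.
have t0 : 0 <= t by lra.
have side u' v' (H' : {set Q}) : (forall q s, u' q != v' s) ->
    alternates u' v' -> injective v' ->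
    (forall i, i \in H' -> excess u' v' o (u' i)) ->
    (forall i, i \in H' -> exists (M : {set Q * V}) (y : Q + V -> R),
      [/\ matching M, adjacent u' v' M, feasible (dist u' v') t M y,
          unmatched M i & a <= y (inl i)]) ->
    {in H' &, forall i j, i != j -> a <= t * `|u' i - u' j|} ->
    a * #|H'|%:R <= t * (t + 1) * \sum_i dist u' v' i (o i).
  move=> ne' alt' iv' ex hH' sep'.
  have [->|[i0 i0H]] := set_0Vmem H'.
    by rewrite cards0 mulr0 !mulr_ge0 ?sumr_ge0 ?addr_ge0 // => i _; exact: normr_ge0.
  (* Charging starts at the leftmost heavy request, with [T] being [cost_right] and [K] being
     [t + 1]. *)
  pose lo := u' [arg min_(i < i0 in H') u' i]%O.
  apply: le_trans (_ : t * (t + 1) * cost_right u' v' o lo <= _); last first.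
    by rewrite ler_wpM2l ?mulr_ge0 ?addr_ge0 ?cost_right_le.
  rewrite /lo; case: arg_minP => // i iH imin; have {}iH : i \in H' := iH.
  apply: (@charged_card _ _ u') => //; rewrite ?addr_ge0 //; try lra.
  - by move=> x; apply: cost_right_ge0.
  - by move=> x x'; apply: cost_right_mono.
  move=> j jH; have [M [y [mM aM fM jM aj]]] := hH' j jH.
  have [|f [jf hf]] := excess_charge t0 ne' alt' iv' io mM aM fM _ (ex j jH).
    by move=> s; move/forallP: jM => /(_ s) /negbTE ->.
  by exists f; split=> //; lra.
pose H1 := [set i in H | excess u v o (u i)].
pose H2 := [set i in H | ~~ excess u v o (u i)].
have -> : #|H|%:R = #|H1|%:R + #|H2|%:R :> R.
  rewrite -natrD; congr _%:R.
  rewrite -(cardsID [set i | excess u v o (u i)] H).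
  by congr (_ + _)%N; apply: eq_card => i; rewrite !inE // andbC.
have h1 := side u v H1 ne alt iv.
have h2 := side (\- u) (\- v) H2 _ (alternatesN iu alt) _.
have -> : 2 * t * (t + 1) * \sum_i dist u v i (o i) =
  t * (t + 1) * \sum_i dist u v i (o i) +
  t * (t + 1) * \sum_i dist (\- u) (\- v) i (o i).
  by under [X in _ = _ + _ * X]eq_bigr do rewrite distN; ring.
rewrite mulrDr; apply: lerD.
  apply: h1.
  - by move=> i /[!inE] /andP[].
  - by move=> i /[!inE] /andP[iH _]; apply: hH.
  - by move=> i j /[!inE] /andP[iH _] /andP[jH _]; apply: sep.
apply: h2.
- by move=> *; rewrite eqr_opp.
- by move=> s s' /oppr_inj /iv.
- by move=> i /[!inE] /andP[_]; apply: excessN.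
- move=> i /[!inE] /andP[/hH [M [y [mM aM fM iM ai]]] _]; exists M, y.
  by split=> //; [apply: adjacentN|apply: feasibleN].
- move=> i j /[!inE] /andP[iH _] /andP[jH _] ij /=.
  by rewrite -opprD normrN; apply: sep.
Qed.
End Weight.

(** * Alternating paths as paths of the residual graph *)

Section Paths.
Variables (R : realType) (n : nat) (S : {fset R}) (r : 'I_n -> R) (t : R).
Implicit Types (M P : {set edge n S}) (x z : vertex n S)
  (p : seq (vertex n S)) (y : vertex n S -> R).

Let d (q : 'I_n) (s : S) : R := dist r (fun s : S => val s) q s.

Definition position x : R :=
  match x with inl q => r q | inr s => val s end.

(** The length of a residual step, which makes the t-net-cost an additive path length. *)
Definition residual_cost x z : R :=
  match x, z with
  | inl q, inr s => t * d q s
  | inr s, inl q => - d q s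
  | _, _ => 0
  end.

Lemma in_symdiff (T : finType) (A B : {set T}) e :
  (e \in symdiff A B) = (e \in A) (+) (e \in B).
Proof. by rewrite !inE; case: (e \in A); case: (e \in B). Qed.

Lemma path_edges_cons x z p e : edge_between x z = Some e ->
  path_edges x (z :: p) = e :: path_edges z p.
Proof. by rewrite /path_edges /= => ->. Qed.

Lemma edge_set_cons x z p e : edge_between x z = Some e ->
  edge_set x (z :: p) = e |: edge_set z p.
Proof.
by move=> exz; apply/setP => f; rewrite /edge_set (path_edges_cons _ exz) !inE.
Qed.

Lemma mem_path_edges x p (e : edge n S) : e \in path_edges x p ->
  (inl e.1 \in x :: p) && (inr e.2 \in x :: p).
Proof.
elim: p x => [//|z p IH] x; rewrite /path_edges /=.
case exz : (edge_between x z) => [f|] /=.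
  rewrite inE => /predU1P[->|].
    by case: x z exz => [q|s] [q'|s'] //= [<-] /=; rewrite !inE !eqxx ?orbT.
  by move/IH/andP => [h1 h2]; rewrite inE h1 [X in _ && X]inE h2 !orbT.
by move/IH/andP => [h1 h2]; rewrite inE h1 [X in _ && X]inE h2 !orbT.
Qed.

Lemma notin_edge_set x z p e : edge_between x z = Some e ->
  x \notin z :: p -> e \notin edge_set z p.
Proof.
move=> exz xzp; rewrite inE; apply: contra xzp => /mem_path_edges/andP[].
by case: x z exz => [q|s] [q'|s'] //= [<-].
Qed.

(* The coercion of a sum to [bool] is [true] on [inl]: residual edges leaving a
   request are outside of [M], those leaving a server are in [M]. *)
Lemma residual_edge M x z : residual M x z ->
  exists2 e, edge_between x z = Some e & (e \in M) = ~~ (x : 'I_n + S).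
Proof.
case: x z => [q|s] [q'|s'] //= h; first by exists (q, s'); rewrite ?(negbTE h).
by exists (q', s).
Qed.

Lemma cost_set1U e P : e \notin P -> cost r (e |: P) = d e.1 e.2 + cost r P.
Proof. by move=> eP; rewrite /cost big_setU1. Qed.

Lemma net_cost_cons M x z p : uniq [:: x, z & p] -> residual M x z ->
  net_cost r t M (edge_set x (z :: p)) =
    residual_cost x z + net_cost r t M (edge_set z p).
Proof.
move=> /= /andP[xzp _] rxz; have [e exz eM] := residual_edge rxz.
rewrite (edge_set_cons _ exz); have eP := notin_edge_set exz xzp.
rewrite /net_cost; case: (boolP (e \in M)) eM => eM /esym xM.
  have -> : (e |: edge_set z p) :\: M = edge_set z p :\: M.
    by apply/setP => f; rewrite !inE; case: eqP => // ->; rewrite eM.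
  have -> : (e |: edge_set z p) :&: M = e |: (edge_set z p :&: M).
    by apply/setP => f; rewrite !inE; case: eqP => // ->; rewrite eM.
  rewrite cost_set1U; last by rewrite inE negb_and eP.
  by case: x z xM exz {xzp rxz eP} => [q|s] [q'|s'] //= _ [<-] /=; ring.
have -> : (e |: edge_set z p) :\: M = e |: (edge_set z p :\: M).
  by apply/setP => f; rewrite !inE; case: eqP => // ->; rewrite eM.
have -> : (e |: edge_set z p) :&: M = edge_set z p :&: M.
  by apply/setP => f; rewrite !inE; case: eqP => // ->; rewrite (negbTE eM) !andbF.
rewrite cost_set1U; last by rewrite inE negb_and eP orbT.
by case: x z xM exz {xzp rxz eP} => [q|s] [q'|s'] //= _ [<-] /=; ring.
Qed.

Lemma net_cost_nil M x : net_cost r t M (edge_set x [::]) = 0.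
Proof.
rewrite /net_cost /edge_set /path_edges /=.
have -> : [set e in [::]] = set0 :> {set edge n S} by apply/setP => e; rewrite !inE.
by rewrite set0D set0I /cost !big_set0 mulr0 subr0.
Qed.

Lemma net_cost_tight M y x p : feasible d t M y -> uniq (x :: p) ->
  path (tight d t M y) x p ->
  net_cost r t M (edge_set x p) = y x - y (last x p).
Proof.
move=> fy; elim: p x => [|z p IH] x; first by rewrite net_cost_nil subrr.
move=> uxp /= /andP[xz zp]; rewrite net_cost_cons //; last first.
  by case: x z xz {IH uxp zp} => [q|s] [q'|s'] //= /andP[].
rewrite IH //; last by case/andP: uxp.
case: x z xz {IH uxp zp} => [q|s] [q'|s'] //=.
  by case/andP=> _ /eqP ->; ring.
by move/(feasible_matched fy) ->; ring.
Qed.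

(** The potential drop is a lower bound on the cost of every step and telescopes; equality for the
    whole path leaves no slack on any step. *)
Lemma net_cost_residual M y x p : feasible d t M y -> uniq (x :: p) ->
  path (residual M) x p ->
  y x - y (last x p) <= net_cost r t M (edge_set x p) /\
  (net_cost r t M (edge_set x p) <= y x - y (last x p) ->
   path (tight d t M y) x p).
Proof.
move=> fy; elim: p x => [|z p IH] x; first by rewrite net_cost_nil subrr.
move=> uxp /= /andP[xz zp]; rewrite net_cost_cons //.
have [|h1 h2] := IH z _ zp; first by case/andP: uxp.
have st : y x - y z <= residual_cost x z.
  case: x z xz {IH uxp zp h1 h2} => [q|s] [q'|s'] //= h.
    by have := feasible_le fy q s'; lra.
  by rewrite (feasible_matched fy h); lra.
split; first by lra.
move=> le; have {}h2 := h2 ltac:(lra); rewrite h2 andbT.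
case: x z xz st le {IH uxp zp h2} h1 => [q|s] [q'|s'] //= h st le h1.
rewrite h /=; apply/eqP; have := feasible_le fy q s'; lra.
Qed.

Lemma position_dist_le M x p : uniq (x :: p) -> path (residual M) x p ->
  `|position x - position (last x p)| <= cost r (edge_set x p).
Proof.
elim: p x => [|z p IH] x.
  by move=> _ _; rewrite subrr normr0; apply: sumr_ge0 => e _; exact: normr_ge0.
move=> uxp /= /andP[xz zp]; have [e exz _] := residual_edge xz.
rewrite (edge_set_cons _ exz) cost_set1U; last first.
  by apply: notin_edge_set exz _; case/andP: uxp.
apply: le_trans (ler_distD (position z) _ _) _; apply: lerD.
  case: x z exz {IH uxp xz zp} => [q|s] [q'|s'] // [<-] /=; rewrite /d /dist //.
  by rewrite distrC.
by apply: IH zp; case/andP: uxp.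
Qed.

(** Alternation determines membership in [M] along the path once the first edge is known, which is
    the purpose of the last hypothesis. *)
Lemma alternating_residual M x p :
  path (fun w z => edge_between w z) x p ->
  sorted (fun e f => (e \in M) != (f \in M)) (path_edges x p) ->
  (forall e, ohead (path_edges x p) = Some e -> (e \in M) = ~~ (x : 'I_n + S)) ->
  path (residual M) x p.
Proof.
elim: p x => [//|z p IH] x /= /andP[xz zp].
case exz : (edge_between x z) xz => [e|] // _.
rewrite (path_edges_cons _ exz) /= => srt /(_ e erefl) eM; apply/andP; split.
  by case: x z exz eM {zp IH srt} => [q|s] [q'|s'] //= [<-] ->.
have zx : (z : bool) = ~~ x by case: x z exz {zp IH srt eM} => [q|s] [q'|s'].
apply: IH => // [|f]; first exact: path_sorted srt.
case: (path_edges z p) srt => // f' l /= /andP[+ _] [<-].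
by rewrite eM zx; case: (f' \in M); case: (x : bool).
Qed.

Lemma residual_alternating M x p : path (residual M) x p ->
  path (fun w z => edge_between w z) x p /\
  sorted (fun e f => (e \in M) != (f \in M)) (path_edges x p).
Proof.
elim: p x => [//|z p IH] x /= /andP[xz zp].
have [e exz eM] := residual_edge xz; have [h1 h2] := IH _ zp.
rewrite exz h1 (path_edges_cons _ exz); split=> //.
case: p zp {IH h1} h2 => [//|w p] /= /andP[zw _].
have [f ezw fM] := residual_edge zw; rewrite (path_edges_cons _ ezw) /= => ->.
rewrite eM fM andbT; by case: x z exz {xz zw eM fM ezw} => [q|s] [q'|s'].
Qed.

Lemma candidate_residual M i p s : unmatched M i ->
  candidate_path M i p s =
  [&& uniq (inl i :: p), path (residual M) (inl i) p, last (inl i) p == inr s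
    & unused M s].
Proof.
move=> iM; apply/idP/idP; last first.
  case/and4P=> up /residual_alternating[h1 h2] lp fs.
  by apply/andP; split; [apply/and3P|apply/andP].
case/andP=> /and3P[up h1 h2] /andP[lp fs]; apply/and4P; split=> //.
apply: alternating_residual => // e.
case: p h1 {up h2 lp} => [|[q|s'] p] //= _.
by rewrite /path_edges /= => -[<-]; apply/negbTE; exact: (forallP iM s').
Qed.

Lemma tight_residual M y x z : tight d t M y x z -> residual M x z.
Proof. by case: x z => [q|s] [q'|s'] //= /andP[]. Qed.

(** Induction on the path, two edges at a time: handing [s] over from [q1] to [q] gives a matching
    [N] that leaves [q1] unmatched, and the rest of the path augments [N] from [q1]. *)
Lemma augment_matching M q p f : matching M -> unmatched M q ->
  uniq (inl q :: p) -> path (residual M) (inl q) p ->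
  last (inl q) p = inr f -> unused M f ->
  let M' := symdiff M (edge_set (inl q) p) in
  [/\ matching M', forall q', unmatched M' q' = (q' != q) && unmatched M q' &
      forall s, unused M' s -> unused M s].
Proof.
have [k] := ubnP (size p); elim: k => // k IH in p q M *.
case: p => [//|[//|s] p] le_k [M1 M2] qM; rewrite [path _ _ _]/=.
have noq s' : ((q, s') \in M) = false by apply/negbTE/(forallP qM).
case: p le_k => [_ _ _ [->] fM|[q1|s'] p le_k uqp /=]; last by rewrite andbF.
  have nof q' : ((q', f) \in M) = false by apply/negbTE/(forallP fM).
  rewrite (edge_set_cons _ (erefl : edge_between (inl q) (inr f) = Some (q, f))).
  set M' := symdiff _ _; have M'E e : (e \in M') = (e == (q, f)) || (e \in M).
    rewrite in_symdiff /edge_set /path_edges /= !inE orbF.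
    by case: eqP => [->|]; rewrite ?noq //= addbF.
  split.
  - split=> [q' s1 s2|q1 q2 s']; rewrite !M'E.
      case/predU1P=> [E1|h1] /predU1P[E2|h2].
      + congruence.
      + by case: E1 h2 => -> _; rewrite noq.
      + by case: E2 h1 => -> _; rewrite noq.
      + exact: M1 h1 h2.
    case/predU1P=> [E1|h1] /predU1P[E2|h2].
    + congruence.
    + by case: E1 h2 => _ ->; rewrite nof.
    + by case: E2 h1 => _ ->; rewrite nof.
    + exact: M2 h1 h2.
  - move=> q'; apply/forallP/andP => [h|[q'q /forallP h] s'].
      split; last by apply/forallP => s'; have := h s'; rewrite M'E negb_or => /andP[].
      by apply: contraTneq (h f) => ->; rewrite M'E eqxx.
    by rewrite M'E negb_or h andbT; apply: contraNneq q'q => -[->].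
  - move=> s' /forallP h; apply/forallP => q'; have := h q'.
    by rewrite M'E negb_or => /andP[].
move=> /and3P[_ q1s pp] lp fM.
have uq1p : uniq (inl q1 :: p) by move: uqp => /= /and3P[].
have [qq1 qp] : q1 != q /\ inl q \notin p.
  by move: uqp; rewrite /= !inE !negb_or => /andP[/and3P[_ h ->]] _; rewrite eq_sym.
have sp : inr s \notin p by move: uqp; rewrite /= !inE !negb_or => /and3P[].
pose N := (q, s) |: (M :\ (q1, s)).
have NE e : (e \in N) = (e == (q, s)) || ((e != (q1, s)) && (e \in M)).
  by rewrite !inE.
have -> : symdiff M (edge_set (inl q) [:: inr s, inl q1 & p]) =
          symdiff N (edge_set (inl q1) p).
  apply/setP => e; rewrite !in_symdiff NE.
  rewrite (edge_set_cons _ (erefl : edge_between (inl q) (inr s) = Some (q, s))).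
  rewrite (edge_set_cons _ (erefl : edge_between (inr s) (inl q1) = Some (q1, s))).
  rewrite in_setU1 in_setU1.
  case: eqP => [->|_] /=.
    rewrite noq; apply/esym/negP; rewrite inE => /mem_path_edges /=; rewrite !inE.
    by rewrite (negbTE qp) orbF => /andP[/eqP[e1]]; rewrite e1 eqxx in qq1.
  case: eqP => [->|_] //=; rewrite q1s /=.
  apply/esym/negP; rewrite inE => /mem_path_edges /=; rewrite !inE.
  by rewrite (negbTE sp) andbF.
have [|||||||m1 m2 m3] := IH p q1 N; rewrite ?NE //.
- by move: le_k => /=; lia.
- split=> [q' s1 s2|q' q2 s']; rewrite !NE.
    case/predU1P=> [E1|/andP[h1 h1']] /predU1P[E2|/andP[h2 h2']].
    + congruence.
    + by case: E1 h2' => -> _; rewrite noq.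
    + by case: E2 h1' => -> _; rewrite noq.
    + exact: M1 h1' h2'.
  case/predU1P=> [E1|/andP[h1 h1']] /predU1P[E2|/andP[h2 h2']].
  + congruence.
  + by case: E1 h2 h2' => _ -> h2 /M2 /(_ q1s) e; rewrite e eqxx in h2.
  + by case: E2 h1 h1' => _ -> h1 /M2 /(_ q1s) e; rewrite e eqxx in h1.
  + exact: M2 h1' h2'.
- apply/forallP => s'; rewrite NE negb_or xpair_eqE (negbTE qq1) /=.
  by apply/negP => /andP[h /M1 /(_ q1s) e]; rewrite e eqxx in h.
(* [M] and [N] differ only in edges at [s], which the rest of the path avoids. *)
- apply: (@sub_in_path _ (fun x => (x != inl q) && (x != inr s))
    (residual M)) pp => [x z /andP[x1 x2] /andP[z1 z2]|].
    case: x z x1 x2 z1 z2 => [a|a] [b|b] //= x1 x2 z1 z2; rewrite NE !xpair_eqE.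
      by rewrite (inj_eq inr_inj) in z2; rewrite (negbTE z2) !andbF.
    rewrite (inj_eq inr_inj) in x2; by rewrite (negbTE x2) !andbF.
  apply/allP => x; rewrite inE => /predU1P[->|xp].
    by rewrite (inj_eq inl_inj) qq1.
  by apply/andP; split; apply: contraTneq xp => ->.
- apply/forallP => q'; rewrite NE negb_or negb_and negbK.
  have -> /= : (q', f) \notin M by exact: (forallP fM).
  rewrite orbT andbT; apply/eqP => -[_ fs].
  have : inr f \in inl q1 :: p by rewrite -lp mem_last.
  by rewrite fs inE /= (negbTE sp).
split=> // [q'|s' /m3 /forallP h].
  rewrite m2; have [->|q'q1] := eqVneq q' q1.
    by rewrite qq1; apply/esym/negbTE/forallPn; exists s; rewrite negbK.
  apply/forallP/andP => /= [h|[q'q /forallP h] s'].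
    split; last first.
      apply/forallP => s'; have := h s'; rewrite NE negb_or !xpair_eqE.
      by rewrite (negbTE q'q1) /= => /andP[].
    by apply: contraTneq (h s) => ->; rewrite NE eqxx.
  by rewrite NE xpair_eqE (negbTE q'q) /= negb_and h orbT.
apply/forallP => q'; have [e|s's] := eqVneq s' s.
  by have := h q; rewrite e NE eqxx.
have := h q'; rewrite NE !xpair_eqE (negbTE s's) !andbF /=; exact.
Qed.
End Paths.

(** * Invariants of the offline algorithm and size of the instance *)

Section Run.
Variables (R : realType) (n : nat) (S : {fset R}) (r : 'I_n -> R) (t : R).
Hypothesis t1 : 1 < t.
Hypothesis ecost_gt0 : forall e : edge n S, 0 < ecost r e.
Hypothesis alt : alternating_instance S r.
Implicit Types (M P : {set edge n S}) (p : seq (vertex n S))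
  (y : vertex n S -> R) (q : 'I_n).

Let v (s : S) : R := val s.
Let d : 'I_n -> S -> R := dist r v.

Let t0 : 0 <= t. Proof. exact: le_trans ler01 (ltW t1). Qed.

Lemma request_neq_server q (s : S) : r q != v s.
Proof. by have := ecost_gt0 (q, s); rewrite normr_gt0 subr_eq0. Qed.

(** [adjacent_tight] applies to each new edge in turn: the request [q0] it asks for is the previous
    request on the path, whose tight edge leads to the partner of the current one. *)
Lemma adjacent_tight_path M y q p : matching M -> adjacent r v M ->
  feasible d t M y -> path (tight d t M y) (inl q) p ->
  (forall s, (q, s) \in M ->
     exists q0, y (inl q0) = t * d q0 s + y (inr s)) ->
  forall e, e \in path_edges (inl q) p -> e \notin M ->
    y (inl e.1) = t * d e.1 e.2 + y (inr e.2) /\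
    forall w, ~~ between (r e.1) (v e.2) (v w).
Proof.
move=> [M1 M2] ad fy; have [k] := ubnP (size p).
elim: k => // k IH in p q *; case: p => [//|[q'|s] p] le_k //=.
case/andP=> /andP[qs /eqP tqs] pp hq e.
rewrite (path_edges_cons _ (erefl : edge_between (inl q) (inr s) = Some (q, s))).
rewrite inE => /predU1P[->|] /=.
  move=> _; split=> // w.
  exact: (adjacent_tight _ t1 request_neq_server alt ad fy tqs hq).
case: p le_k pp => [//|[q1|s'] p] le_k //= /andP[q1s pp].
rewrite (path_edges_cons _ (erefl : edge_between (inr s) (inl q1) = Some (q1, s))).
rewrite inE => /predU1P[-> /negP //|].
apply: IH => //; first by move: le_k => /=; lia.
by move=> s' /M1 /(_ q1s) ->; exists q.
Qed.

Definition valid_state (k : nat) M : Prop :=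
  [/\ matching M, adjacent r v M, forall q, unmatched M q = (k <= q)%N
    & exists y, feasible d t M y].

Lemma valid_state0 : valid_state 0 set0.
Proof.
split.
- by split=> [q s s'|q q' s]; rewrite inE.
- by move=> q s w; rewrite inE.
- by move=> q; apply/forallP => s; rewrite inE.
- exists (fun=> 0); split=> // q s; last by rewrite inE.
  by rewrite addr0 mulr_ge0 // normr_ge0.
Qed.

(** The dual solution provides a tight candidate path of net-cost [y (inl q)]. An optimal path costs
    no more, and the potential allows no less, so it is tight as well; its new edges then preserve
    adjacency and a feasible potential. *)
Lemma optimal_path_step M q p s : valid_state q M ->
  candidate_path M q p s ->
  (forall p' s', candidate_path M q p' s' ->
     net_cost r t M (edge_set (inl q) p) <= net_cost r t M (edge_set (inl q) p')) ->
  (exists2 y, feasible d t M y & y (inl q) = net_cost r t M (edge_set (inl q) p))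
  /\ valid_state q.+1 (symdiff M (edge_set (inl q) p)).
Proof.
move=> [mM ad uM [y0 fy0]] cp opt; have qM : unmatched M q by rewrite uM.
have noq s' : (q, s') \in M -> False by move=> h; have := forallP qM s'; rewrite h.
have [up pp /eqP lp us] : [/\ uniq (inl q :: p), path (residual M) (inl q) p,
    last (inl q) p == inr s & unused M s].
  by move: cp; rewrite candidate_residual // => /and4P[].
have [y [f [fy uf /connectP[p0 p0t ]]]] := feasible_augmentable mM qM us fy0.
case/shortenP: p0t => p' p't p'u _ lp'.
have := net_cost_tight fy p'u p't; rewrite -lp' (feasible_unused fy uf) subr0.
move=> np'; have : candidate_path M q p' f.
  rewrite candidate_residual //; apply/and4P; split=> //; last by rewrite -lp'.
  by apply: sub_path p't; apply: tight_residual.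
move/opt; rewrite np' => le.
have [] := net_cost_residual fy up pp; rewrite lp (feasible_unused fy us) subr0.
move=> ge /(_ le) pt; split; first by exists y => //; apply/eqP; rewrite eq_le ge le.
have [mM' uM' uM's] := augment_matching mM qM up pp lp us.
have adt := adjacent_tight_path mM ad fy pt (fun s' h => False_ind _ (noq s' h)).
have M'P e : e \in symdiff M (edge_set (inl q) p) -> e \notin M ->
    y (inl e.1) = t * d e.1 e.2 + y (inr e.2) /\
    forall w, ~~ between (r e.1) (v e.2) (v w).
  rewrite in_symdiff => h eM; apply: adt => //; move: h.
  by rewrite (negbTE eM) /= inE.
split=> //.
- move=> q' s' w h; have [|/(M'P _ h)[_]] := boolP ((q', s') \in M); last exact.
  exact: ad.
- by move=> q'; rewrite uM' uM ltn_neqAle eq_sym.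
- apply: (feasible_rematch (ltW t1) _ mM' _ uM's fy).
    by move=> *; exact: normr_ge0.
  move=> q' s' h ne; have /(M'P _ h)[//] : (q', s') \notin M.
  by apply/negP => /(feasible_matched fy).
Qed.

Lemma cost_ge0 M : 0 <= cost r M.
Proof. by apply: sumr_ge0 => e _; exact: normr_ge0. Qed.

Lemma cost_subset M P : M \subset P -> cost r M <= cost r P.
Proof.
move=> MP; rewrite /cost [X in _ <= X](big_setID M) /= (setIidPr MP) lerDl.
by apply: sumr_ge0 => e _; exact: normr_ge0.
Qed.

Lemma cost_setID M P : cost r P = cost r (P :\: M) + cost r (P :&: M).
Proof. by rewrite /cost (big_setID M) /= addrC. Qed.

Lemma cost_symdiff M P :
  cost r (symdiff M P) = cost r M + cost r (P :\: M) - cost r (P :&: M).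
Proof.
rewrite (cost_setID P M) (cost_setID M (symdiff M P)).
have -> : symdiff M P :\: M = P :\: M.
  by apply/setP => e; rewrite !inE; case: (e \in M); rewrite ?andbF ?andbT ?orbF.
have -> : symdiff M P :&: M = M :\: P.
  by apply/setP => e; rewrite !inE; case: (e \in M); rewrite ?andbT ?andbF ?orbF.
by rewrite [P :&: M]setIC; ring.
Qed.

Lemma cost_online (o : 'I_n -> S) : cost r (online_matching o) = \sum_i d i (o i).
Proof.
rewrite /cost /online_matching big_imset /=; first by apply: eq_bigl => i; rewrite inE.
by move=> i j _ _ [].
Qed.

Lemma ecost_ratio_le (e f : edge n S) : ecost r e <= Delta S r * ecost r f.
Proof.
rewrite -ler_pdivrMr //; apply: le_trans (le_bigmax _ _ e).
exact: (le_bigmax _ (fun f => ecost r e / ecost r f) f).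
Qed.

Lemma Delta_ge1 (e : edge n S) : 1 <= Delta S r.
Proof. by have := ecost_ratio_le e e; rewrite -ler_pdivrMr // divff ?gt_eqF. Qed.

(** A server between two requests keeps them at least twice the shortest edge apart, while going
    through one common server shows that all requests span at most twice the longest edge. *)
Lemma size_le_Delta (e : edge n S) : n%:R <= 1 + Delta S r.
Proof.
have [f fmin] : exists f : edge n S, forall g : edge n S, ecost r f <= ecost r g.
  case: (@arg_minP _ _ _ e xpredT (ecost r) isT) => f _ h.
  by exists f => g; exact: h.
have [hi hiP] : exists hi, forall q, r q <= r hi.
  by case: (@arg_maxP _ _ _ e.1 xpredT r isT) => hi _ h; exists hi => q; exact: h.
have [lo loP] : exists lo, forall q, r lo <= r q.
  by case: (@arg_minP _ _ _ e.1 xpredT r isT) => lo _ h; exists lo => q; exact: h.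
have := @separated_card _ _ r [set: 'I_n] (2 * ecost r f) 1 (r lo) (r hi) ltr01.
rewrite cardsT card_ord !mul1r => /(_ _ (hiP lo)) card.
have {card} : 2 * ecost r f * n%:R <= r hi - r lo + 2 * ecost r f.
  apply: card => [|i _|i j _ _ ij]; first by rewrite mulr_ge0 // ltW.
    by rewrite loP hiP.
  rewrite mul1r; wlog le : i j ij / r i <= r j.
    move=> h; case: (leP (r i) (r j)) => [|/ltW] le; first exact: h.
    by rewrite distrC; apply: h; rewrite // eq_sym.
  have [s /andP[ilts sltj]] := alt ij le.
  have := fmin (i, s); have := fmin (j, s); rewrite [ecost _ (_, s)]/ecost /=.
  rewrite [ecost _ (i, s)]/ecost /= gtr0_norm ?subr_gt0 //.
  by rewrite ltr0_norm ?subr_lt0 // ler0_norm ?subr_le0 //; lra.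
have span : r hi - r lo <= 2 * (Delta S r * ecost r f).
  have := ecost_ratio_le (hi, e.2) f; have := ecost_ratio_le (lo, e.2) f.
  rewrite {1 3}/ecost /= => h1 h2.
  have := ler_distD (val e.2) (r hi) (r lo); have := ler_norm (r hi - r lo).
  rewrite (distrC (val e.2)); lra.
move=> h; have f0 := ecost_gt0 f.
rewrite -(ler_pM2l f0); lra.
Qed.

Lemma ln_size_le (e : edge n S) :
  1 + ln n%:R <= 2 * (1 + ln (Delta S r)).
Proof.
have D1 := Delta_ge1 e; have nD := size_le_Delta e.
have n0 : 0 < n%:R :> R by rewrite ltr0n; exact: leq_ltn_trans (leq0n _) (ltn_ord e.1).
have D0 : 0 < Delta S r by exact: lt_le_trans D1.
(* Since [1 <= Delta], the size bound gives [n <= 2 * Delta], and [ln 2 <= 1] absorbs the factor. *)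
have : ln n%:R <= ln ((1 + 1) * Delta S r).
  by rewrite ler_ln ?posrE ?mulr_gt0 //; lra.
rewrite lnM ?posrE ?addr_gt0 //; have : ln (1 + 1 : R) <= 1.
  by apply: le_ln1Dx; rewrite (lt_trans _ ltr01) // ltrN10.
by have := ln_ge0 D1; lra.
Qed.

(** * Summing net-costs over a complete run *)

Section Execution.
Variables (M : nat -> {set edge n S}) (P : 'I_n -> seq (vertex n S)).
Variable (s : 'I_n -> S).
Hypothesis run : offline_run r t M P s.

Let phi q := net_cost r t (M q) (edge_set (inl q) (P q)).

Lemma run_valid_state k : (k <= n)%N -> valid_state k (M k).
Proof.
case: run => M0 step; elim: k => [_|k IH lt]; first by rewrite M0; exact: valid_state0.
have [cp opt eM] := step (Ordinal lt).
have [_] := optimal_path_step (q := Ordinal lt) (IH (ltnW lt)) cp opt.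
by rewrite -eM.
Qed.

Lemma run_net_cost q : exists2 y, feasible d t (M q) y & y (inl q) = phi q.
Proof.
case: run => M0 step; have [cp opt eM] := step q.
by have [] := optimal_path_step (run_valid_state (ltnW (ltn_ord q))) cp opt.
Qed.

Lemma run_separated (i j : 'I_n) : (i < j)%N -> phi i <= t * `|r i - r j|.
Proof.
move=> ij; have [y fy <-] := run_net_cost i.
have [mM ad uM _] := run_valid_state (ltnW (ltn_ord i)).
have [|||w uw bw] := @unused_between _ _ _ r v (M i) i j request_neq_server alt mM ad.
- by rewrite uM.
- by rewrite uM ltnW.
- by apply: contraTneq ij => ->; rewrite ltnn.
have := feasible_le fy i w; rewrite (feasible_unused fy uw) addr0 => h.
apply: le_trans h _; rewrite ler_wpM2l ?t0 //.
rewrite /d /dist; move: bw; rewrite /between => /orP[]/andP[h1 h2].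
  rewrite distrC gtr0_norm ?subr_gt0 // distrC gtr0_norm ?subr_gt0 ?(lt_trans h1) //.
  by rewrite lerD2r ltW.
by rewrite !gtr0_norm ?subr_gt0 ?(lt_trans h1) // lerD2l lerN2 ltW.
Qed.

Lemma sum_net_cost_le (o : 'I_n -> S) : (0 < n)%N -> injective o ->
  \sum_q phi q <= 2 * t * (t + 1) * (\sum_q d q (o q)) * (1 + ln n%:R).
Proof.
move=> n0 io; set B := 2 * t * (t + 1) * _.
have B0 : 0 <= B.
  by rewrite !mulr_ge0 ?addr_ge0 ?sumr_ge0 // => q _; exact: normr_ge0.
have : \sum_(q in [set: 'I_n]) phi q <= B * \sum_(k < #|[set: 'I_n]|) k.+1%:R^-1.
  apply: sum_weak_type => // a a0.
  apply: (heavy_card t1 a0 request_neq_server alt val_inj io) => [q|i j].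
    rewrite inE => aq; have [mM ad uM _] := run_valid_state (ltnW (ltn_ord q)).
    have [y fy yq] := run_net_cost q; exists (M q), y; split=> //.
      by rewrite uM.
    by rewrite yq.
  rewrite !inE => ai aj ij; have [lt|lt|/val_inj e] := ltngtP i j.
  - exact: le_trans ai (run_separated lt).
  - by rewrite distrC; exact: le_trans aj (run_separated lt).
  - by rewrite e eqxx in ij.
rewrite cardsT card_ord; under eq_bigl do rewrite inE.
move=> h; apply: le_trans h _; rewrite ler_wpM2l //.
by case: n n0 => // m _; exact: sum_inv_le_ln.
Qed.

(** With [A] the total cost added and [D] the total removed, the triangle inequality gives an online
    cost of at most [A + D], and [A - D] is the final offline cost, hence nonnegative. The claim
    follows from [2 * (t * A - D) - (t - 1) * (A + D) = (t + 1) * (A - D)]. *)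
Lemma online_cost_le : (t - 1) * cost r (online_matching s) <= 2 * \sum_q phi q.
Proof.
case: run => M0 step.
pose add q := cost r (edge_set (inl q) (P q) :\: M q).
pose del q := cost r (edge_set (inl q) (P q) :&: M q).
have tele : \sum_q (add q - del q) = cost r (M n).
  transitivity (\sum_(q < n) (cost r (M q.+1) - cost r (M q))).
    apply: eq_bigr => q _; have [_ _ ->] := step q.
    by rewrite cost_symdiff /add /del; ring.
  rewrite -(big_mkord xpredT (fun k => cost r (M k.+1) - cost r (M k))).
  by rewrite telescope_sumr // M0 {2}/cost big_set0 subr0.
have le1 : cost r (online_matching s) <= \sum_q (add q + del q).
  rewrite cost_online; apply: ler_sum => q _; have [cp _ _] := step q.
  have [_ _ uM _] := run_valid_state (ltnW (ltn_ord q)).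
  move: cp; rewrite candidate_residual ?uM // => /and4P[up pp /eqP lp _].
  have := position_dist_le r up pp; rewrite lp /= (cost_setID (M q)).
  exact.
have e : \sum_q phi q = \sum_q (t * add q - del q) by [].
move: tele le1; rewrite {}e !sumrB big_split /= -mulr_sumr.
have := cost_ge0 (M n); set A := \sum_q add q; set D := \sum_q del q.
move=> h0 h1 h2.
have : (t - 1) * cost r (online_matching s) <= (t - 1) * (A + D).
  by rewrite ler_wpM2l // subr_ge0 ltW.
have : 0 <= (t + 1) * (A - D) by rewrite h1 mulr_ge0 // addr_ge0.
lra.
Qed.
End Execution.
End Run.

Theorem theorem15 (R : realType) (t : R) (ht : 1 < t) :
  exists C : R, 0 < C /\
    forall (n : nat) (S : {fset R}) (r : 'I_n -> R),
      (n <= #|` S|)%N ->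
      (forall e : edge n S, 0 < ecost r e) ->
      alternating_instance S r ->
      forall M' : {set edge n S}, online_output r t M' ->
        cost r M' <= C * (1 + ln (Delta S r)) * OPT S r.
Proof.
have t0 : 0 < t by exact: lt_trans ht.
have t1 : 0 < t - 1 by rewrite subr_gt0.
(* The 8 collects a factor 2 from each of [online_cost_le], [sum_net_cost_le] and [ln_size_le]. *)
pose C := 8 * t * (t + 1) / (t - 1).
have Cge1 : 1 <= C.
  rewrite ler_pdivlMr // mul1r.
  have := mulr_gt0 t0 t0; lra.
exists C; split; first exact: lt_le_trans Cge1.
move=> n S r _ pos alt _ [M [P [s [run ->]]]].
case: (posnP n) => [n0|n0].
  have edge0 (A : {set edge n S}) : cost r A = 0.
    by apply: big1 => e _; have := ltn_ord e.1; rewrite [X in (_ < X)%N]n0.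
  suff -> : OPT S r = 0 by rewrite mulr0 edge0.
  by rewrite /OPT edge0; elim/big_ind: _ => // x z -> ->; rewrite minxx.
pose e : edge n S := (Ordinal n0, s (Ordinal n0)).
have D1 := Delta_ge1 pos e; have lnD := ln_size_le pos alt e.
have K1 : 1 <= 1 + ln (Delta S r) by rewrite lerDl ln_ge0.
have CK : 1 <= C * (1 + ln (Delta S r)) by rewrite mulr_ege1.
have CK0 : 0 < C * (1 + ln (Delta S r)) by exact: lt_le_trans CK.
(* The default value of [OPT] is compared separately: it is the cost of all edges, which dominates
   the online cost because the factor is at least 1. *)
rewrite mulrC -ler_pdivrMr //; apply: le_bigmin => [|O /andP[mO aO]].
  rewrite ler_pdivrMr //; apply: le_trans (_ : cost r [set: edge n S] <= _).
    by apply: cost_subset; apply: subsetT.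
  by rewrite ler_peMr // cost_ge0.
have /fin_all_exists[o oO] : forall i, exists s : S, (i, s) \in O.
  by move=> i; apply/existsP; exact: (forallP aO i).
have io : injective o.
  move=> i j eo; have /forall_inP/(_ _ (oO i))/forall_inP/(_ _ (oO j)) := mO.
  by rewrite /= eo eqxx orbT /= => /eqP[].
rewrite ler_pdivrMr //; have oleO : cost r (online_matching o) <= cost r O.
  apply: cost_subset; apply/subsetP => f /imsetP[i _ ->]; exact: oO.
apply: le_trans (_ : cost r (online_matching o) * (C * (1 + ln (Delta S r))) <= _).
  2: by rewrite ler_wpM2r // ltW.
rewrite (cost_online r o); set X := \sum_i _.
have X0 : 0 <= X by apply: sumr_ge0 => i _; exact: normr_ge0.
have h1 := online_cost_le ht pos alt run.
have h2 := sum_net_cost_le ht pos alt run n0 io.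
have h3 : 2 * t * (t + 1) * X * (1 + ln n%:R) <=
    2 * t * (t + 1) * X * (2 * (1 + ln (Delta S r))).
  by rewrite ler_wpM2l // !mulr_ge0 //; lra.
rewrite -(ler_pM2l t1); have -> : (t - 1) * (X * (C * (1 + ln (Delta S r)))) =
    2 * (2 * t * (t + 1) * X * (2 * (1 + ln (Delta S r)))).
  by rewrite /C; field; rewrite gt_eqF.
apply: le_trans h1 _; rewrite ler_wpM2l //; exact: le_trans h2 h3.
Qed.
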